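(* With $n$ ranging over the positive integers, $$\lim_{n\to\infty}\left(\sum_{j=1}^{\infty}\frac{1}{e^{j^{1/n}}-1}-\zeta(n)\,\Gamma(n+1)\right)=\frac{1}{2-2e}.$$
   Context: $\zeta$ is the Riemann zeta function, $\Gamma$ is the Gamma function, and $e$ is the base of natural logarithms. The expression is considered for $n\ge 2$, so that $\zeta(n)$ is finite. *)

(* Defs.v *)
From HB Require Import structures.
From mathcomp Require Import all_boot all_order all_algebra.
From mathcomp Require Import all_classical all_reals all_analysis.

Set Implicit Arguments.
Unset Strict Implicit.
Unset Printing Implicit Defensive.

Import Order.TTheory GRing.Theory Num.Theory.
Import numFieldNormedType.Exports.

Local Open Scope classical_set_scope.
Local Open Scope ring_scope.
Local Open Scope ereal_scope.

(* Riemann zeta on the half-line s > 1, where it is given by its Dirichlet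
   series.  A series of nonnegative terms always has a value in \bar R, and that
   value is finite exactly when the series converges. *)
Definition zeta (R : realType) (s : R) : \bar R :=
  \sum_(1 <= k <oo) ((k%:R `^ s)^-1)%:E.

(* Euler's integral, the Gamma function on x > 0; the integrand is nonnegative,
   so the value in \bar R is always meaningful. *)
Definition Gamma (R : realType) (x : R) : \bar R :=
  \int[lebesgue_measure]_(t in `]0%R, +oo[) (t `^ (x - 1) * expR (- t))%:E.

(* Main.v *)
Require Import Defs.
From HB Require Import structures.
From mathcomp Require Import all_boot all_order all_algebra.
From mathcomp Require Import all_classical all_reals all_analysis.
From mathcomp Require Import measurable_realfun.
From mathcomp Require Import ring lra.

Set Implicit Arguments.
Unset Strict Implicit.
Unset Printing Implicit Defensive.

Import Order.TTheory GRing.Theory Num.Theory.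
Import numFieldNormedType.Exports.

Local Open Scope classical_set_scope.
Local Open Scope ring_scope.

(** The number zeta(n) Gamma(n+1) is the integral over the positive half-line
    of f(x) = 1 / (e^(x^(1/n)) - 1), so the theorem compares the sum of f over
    the positive integers with an integral.  On [1, +oo[ the function f is
    convex and decreasing, and the trapezoidal rule shows that the sum exceeds
    the integral by f(1)/2 = 1 / (2 (e - 1)), up to an error of the order of
    f'(1) = O(1/n).  On ]0, 1[ the function f tends to the constant 1 / (e - 1)
    as n grows, and the integral of f over this interval has that limit.
    The difference therefore tends to
    1 / (2 (e - 1)) - 1 / (e - 1) = 1 / (2 - 2 e).

    All estimates are made on the terms of the expansion of f into the
    geometric series of the functions g_k(x) = e^(- k x^(1/n)), k >= 1.  Each
    g_k has an explicit primitive, a multiple of the regularized incomplete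
    Gamma function Q(n, u) evaluated at u = k x^(1/n), and its integral over the
    half-line is n! / k^n; the sum of these numbers over k is zeta(n) n!.
    - [sum_minus_integral_bounds] is the comparison of sum and integral on
      [1, +oo[, a telescoping sum of the one-step estimates [trapezoid_error];
    - [unit_interval_integral_bounds] bounds the integral of g_k over [0, 1] by
      e^(-k) + O(1 / (n k^2));
    - [exp_root_series_asymptotics] combines both: the sum of g_k over the
      positive integers is n! / k^n - e^(-k) / 2 + O(1 / (n k^2)), uniformly
      in k and n;
    - [double_series_asymptotics] sums this over k, after exchanging the two
      nonnegative summations: the factor 1 / k^2 makes the errors summable and
      the factor 1 / n makes their sum vanish in the limit, while the terms
      e^(-k) / 2 add up to 1 / (2 (e - 1)).
    The exponents n of the estimates are written m.+3. *)

(** * Sums and integrals of convex functions *)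

Lemma is_derive_within_continuous (R : realType) (f f' : R -> R) (a b : R) :
  (forall x, x \in `[a, b] -> is_derive x 1 f (f' x)) ->
  {within `[a, b], continuous f}.
Proof.
move=> df; apply: derivable_within_continuous => x xab.
by have [] := df x xab.
Qed.

(** The primitive F stands for the integral of g.  The error of the trapezoidal
    rule on [a, x], as a function of x, has derivative
    ((x - a) g'(x) - (g(x) - g(a))) / 2; by the mean value theorem for g this
    is (x - a) (g'(x) - g'(d)) / 2 for some d < x, which lies between 0 and
    (b - a) (g'(b) - g'(a)) / 2 because g' is nondecreasing. *)
Lemma trapezoid_error (R : realType) (F g g' : R -> R) (a b : R) : a < b ->
  (forall x, x \in `[a, b] -> is_derive x 1 F (g x)) ->
  (forall x, x \in `[a, b] -> is_derive x 1 g (g' x)) ->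
  {in `[a, b] &, {homo g' : x y / x <= y}} ->
  0 <= (b - a) * (g a + g b) / 2 - (F b - F a)
    <= (b - a) ^+ 2 * (g' b - g' a) / 2.
Proof.
move=> ab dF dg g'_homo.
pose err x := (x - a) * (g a + g x) / 2 - (F x - F a).
pose err' x := ((x - a) * g' x - (g x - g a)) / 2.
have derr x : x \in `[a, b] -> is_derive x 1 err (err' x).
  move=> xab; have dFx := dF x xab; have dgx := dg x xab.
  have -> : err = 2^-1 *: ((id - cst a) * (cst (g a) + g)) - (F - cst (F a)).
    by apply/funext => y; rewrite /err/= !fctE /GRing.scale/= mulrC.
  apply: is_derive_eq.
  by rewrite !fctE /GRing.scale/= /err'; field.
have [c cab] := MVT ab (fun x xab => derr x (subset_itv_oo_cc xab))
  (is_derive_within_continuous derr).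
have cab' := subset_itv_oo_cc cab.
have [ac cb] : a < c /\ c < b by split; rewrite (itvP cab).
have sub x : x \in `[a, c] -> x \in `[a, b].
  by rewrite !in_itv/= => /andP[-> xc]; rewrite (le_trans xc (ltW cb)).
have [d dac eg] := MVT ac
  (fun x xac => dg x (sub x (subset_itv_oo_cc xac)))
  (is_derive_within_continuous (fun x xac => dg x (sub x xac))).
have [ad dc] : a < d /\ d < c by split; rewrite (itvP dac).
have inab x : a <= x -> x <= b -> x \in `[a, b] by rewrite in_itv/= => -> ->.
have g'ad : g' a <= g' d by rewrite g'_homo ?inab//; lra.
have g'dc : g' d <= g' c by rewrite g'_homo ?inab//; lra.
have g'cb : g' c <= g' b by rewrite g'_homo ?inab//; lra.
have erra : err a = 0 by rewrite /err !subrr !mul0r subrr.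
rewrite erra subr0 -/(err b) => ->; rewrite /err' eg.
have -> : ((c - a) * g' c - g' d * (c - a)) / 2 * (b - a) =
  ((c - a) * (g' c - g' d)) * ((b - a) / 2) by field.
have -> : (b - a) ^+ 2 * (g' b - g' a) / 2 =
  ((b - a) * (g' b - g' a)) * ((b - a) / 2) by field.
have ca0 : 0 <= c - a by lra.
have ba0 : 0 <= (b - a) / 2 by lra.
have g'cd0 : 0 <= g' c - g' d by lra.
apply/andP; split; first exact: mulr_ge0 (mulr_ge0 ca0 g'cd0) ba0.
by apply: ler_wpM2r => //; apply: ler_pM => //; lra.
Qed.

(** Since F vanishes at infinity, - F 1 is the integral of g over [1, +oo[.
    The trapezoidal errors on the intervals [j, j + 1] are nonnegative and at
    most (g'(j + 1) - g'(j)) / 2, so they add up to at most - g' 1 / 2; the term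
    g 1 / 2 appears because the trapezoidal rule gives half weight to the
    first value. *)
Lemma sum_minus_integral_bounds (R : realType) (F g g' : R -> R) :
  (forall x : R, 1 <= x -> is_derive x 1 F (g x)) ->
  (forall x : R, 1 <= x -> is_derive x 1 g (g' x)) ->
  (forall x y : R, 1 <= x -> x <= y -> g' x <= g' y) ->
  (forall x : R, 1 <= x -> g' x <= 0) ->
  F j.+1%:R @[j --> \oo] --> 0 -> g j.+1%:R @[j --> \oo] --> 0 ->
  exists2 S : R, (\sum_(0 <= j < N) g j.+1%:R) @[N --> \oo] --> S &
    0 <= S - (g 1 / 2 - F 1) <= - g' 1 / 2.
Proof.
move=> dF dg g'_homo g'_le0 F0 g0.
(* The accumulated trapezoidal error on [1, N + 1]. *)
pose e N := \sum_(0 <= j < N) g j.+1%:R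
  - (g 1 / 2 - F 1) + (g N.+1%:R / 2 - F N.+1%:R).
have eS N : 0 <= e N.+1 - e N <= (g' N.+2%:R - g' N.+1%:R) / 2.
  have NN1 : N.+1%:R < N.+2%:R :> R by rewrite ltr_nat.
  have ge1 x : x \in `[N.+1%:R, N.+2%:R] -> 1 <= x :> R.
    by rewrite in_itv/= => /andP[+ _]; apply: le_trans; rewrite ler1n.
  have := trapezoid_error NN1 (fun x xN => dF x (ge1 x xN))
    (fun x xN => dg x (ge1 x xN))
    (fun x y xN yN => g'_homo x y (ge1 x xN)).
  have -> : N.+2%:R - N.+1%:R = 1 :> R by rewrite -natrB// subSnn.
  by rewrite mul1r expr1n mul1r /e big_nat_recr//=; lra.
have e0 : e 0%N = 0 by rewrite /e big_geq// sub0r addNr.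
have e_ge0 N : 0 <= e N.
  elim: N => [|N IH]; first by rewrite e0.
  by have /andP[+ _] := eS N; lra.
have e_le N : e N <= (g' N.+1%:R - g' 1) / 2.
  elim: N => [|N IH]; first by rewrite e0 subrr mul0r.
  by have /andP[_ +] := eS N; lra.
have e_leM N : e N <= - g' 1 / 2.
  have := e_le N; have := g'_le0 N.+1%:R; rewrite ler1n => /(_ isT).
  by lra.
have ecvg : cvgn e.
  apply: nondecreasing_is_cvgn.
    by apply/nondecreasing_seqP => N; have /andP[+ _] := eS N; rewrite subr_ge0.
  by exists (- g' 1 / 2) => _ [N _ <-]; exact: e_leM.
exists (limn e + (g 1 / 2 - F 1)); last first.
  rewrite addrK; apply/andP; split.
    by apply: limr_ge => //; near=> N; exact: e_ge0.
  by apply: limr_le => //; near=> N; exact: e_leM.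
rewrite (_ : (fun N => _) =
    (fun N => e N + (g 1 / 2 - F 1) - (g N.+1%:R / 2 - F N.+1%:R))); last first.
  by apply/funext => N; rewrite /e; ring.
rewrite -[X in _ --> X]subr0; apply: cvgB.
  by apply: cvgD => //; exact: cvg_cst.
rewrite -[0]subr0 -[X in X - _](mul0r 2^-1); apply: cvgB => //.
by apply: cvgM => //; exact: cvg_cst.
Unshelve. all: by end_near. Qed.

(** * Incomplete Gamma function at positive integers *)

(** For n >= 1 this is Q(n, u), the integral of t^(n-1) e^(-t) over [u, +oo[
    divided by (n-1)!; the closed form gives primitives of the integrands below
    without any integration. *)
Definition reg_upper_gamma (R : realType) (n : nat) (u : R) : R :=
  expR (- u) * \sum_(i < n) u ^+ i / i`!%:R.

Lemma reg_upper_gamma0 (R : realType) n : reg_upper_gamma n.+1 (0 : R) = 1.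
Proof.
rewrite /reg_upper_gamma oppr0 expR0 mul1r big_ord_recl/= expr0 fact0 divr1.
by rewrite big1 ?addr0// => i _; rewrite expr0n/= mul0r.
Qed.

Lemma reg_upper_gammaS (R : realType) n (u : R) :
  reg_upper_gamma n.+1 u = reg_upper_gamma n u + expR (- u) * (u ^+ n / n`!%:R).
Proof. by rewrite /reg_upper_gamma big_ord_recr/= mulrDr. Qed.

Lemma is_derive_expRNM (R : realType) (k x : R) :
  is_derive x 1 (fun y => expR (- (k * y))) (- k * expR (- (k * x))).
Proof.
have -> : (fun y => expR (- (k * y))) = expR \o (- (k *: id)) by [].
by apply: is_derive_eq; rewrite /GRing.scale/= mulr1 mulrC.
Qed.

Lemma is_derive_reg_upper_gamma (R : realType) n (u : R) :
  is_derive u 1 (reg_upper_gamma n.+1) (- (expR (- u) * (u ^+ n / n`!%:R))).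
Proof.
have dN : is_derive u 1 (fun v => expR (- v)) (- expR (- u)).
  have := is_derive_expRNM 1 u; rewrite mulN1r mul1r.
  by under eq_fun do rewrite mul1r.
elim: n => [|n IH].
  rewrite (_ : reg_upper_gamma 1 = fun v => expR (- v)).
    by rewrite expr0 fact0 divr1 mulr1.
  by apply/funext => v; rewrite /reg_upper_gamma big_ord1 expr0 fact0 divr1 mulr1.
rewrite (_ : reg_upper_gamma n.+2 = reg_upper_gamma n.+1 +
    (fun v => expR (- v)) * (n.+1`!%:R^-1 *: (id ^+ n.+1))); last first.
  apply/funext => v; rewrite reg_upper_gammaS.
  by rewrite !fctE /GRing.scale/= [X in _ + _ * X]mulrC.
apply: (is_derive_eq (is_deriveD IH (is_deriveM dN
  (is_deriveZ n.+1`!%:R^-1 (is_deriveX n.+1 (is_derive_id u 1)))))).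
rewrite !fctE /= /GRing.scale /= factS natrM.
have n1 : n.+1%:R != 0 :> R by rewrite pnatr_eq0.
have nf : n`!%:R != 0 :> R by rewrite pnatr_eq0 -lt0n fact_gt0.
by field; rewrite nat1r n1 nf.
Qed.

(** A single term of the exponential series of u is at most e^u.  For n = 3
    this supplies the decay 6 / u^3 of e^(-u) used below. *)
Lemma poisson_weight_le1 (R : realType) n (u : R) :
  0 <= u -> expR (- u) * (u ^+ n / n`!%:R) <= 1.
Proof.
move=> u0; rewrite expRN ler_pdivrMl ?expR_gt0// mulr1.
case: n => [|n]; first by rewrite expr0 fact0 divr1 -expR0 ler_expR.
by apply: le_trans (expR_ge1Dxn n u0); rewrite lerDr.
Qed.

Lemma cvg_reg_upper_gamma (R : realType) n :
  reg_upper_gamma n x @[x --> +oo] --> (0 : R).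
Proof.
elim: n => [|n IH].
  rewrite (_ : reg_upper_gamma 0 = cst 0); first exact: cvg_cst.
  by apply/funext => v; rewrite /reg_upper_gamma big_ord0 mulr0.
rewrite (_ : reg_upper_gamma n.+1 = reg_upper_gamma n \+
    (fun u => expR (- u) * (u ^+ n / n`!%:R))); last first.
  by apply/funext => u; exact: reg_upper_gammaS.
rewrite -[X in _ --> X]addr0; apply: (cvgD IH).
apply: (squeeze_cvgr (f := cst 0) (h := fun u => n.+1%:R * u^-1)).
- near=> u.
  have u0 : 0 < u by near: u; exact: nbhs_pinfty_gt.
  rewrite mulr_ge0 ?expR_ge0 ?divr_ge0 ?exprn_ge0 ?(ltW u0)//=.
  rewrite ler_pdivlMr//.
  have := poisson_weight_le1 n.+1 (ltW u0).
  (* The bound on the weight of index n + 1 gives the factor n.+1 / u. *)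
  rewrite factS natrM exprSr invfM.
  rewrite (_ : _ * _ = expR (- u) * (u ^+ n / n`!%:R) * u / n.+1%:R); last by ring.
  by rewrite ler_pdivrMr ?ltr0n// mul1r.
- exact: cvg_cst.
- rewrite -[0](mulr0 n.+1%:R); apply: cvgM; first exact: cvg_cst.
  by apply/gtr0_cvgV0; [exact: nbhs_pinfty_gt|exact: cvg_id].
Unshelve. all: by end_near. Qed.

(** - n! Q(n + 1, t) is a primitive of t^n e^(-t); it equals - n! at 0 and
    vanishes at infinity. *)
Lemma Gamma_natS (R : realType) n :
  Gamma (n%:R + 1 : R) = (n`!%:R)%:E.
Proof.
rewrite /Gamma addrK.
pose f (t : R) := expR (- t) * t ^+ n.
have cf : continuous f.
  move=> t; apply: cvgM; last exact: exprn_continuous.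
  by apply: continuous_comp; [exact: continuousN|exact: continuous_expR].
transitivity (\int[lebesgue_measure]_(t in `]0%R, +oo[) (f t)%:E)%E.
  apply: eq_integral => t; rewrite inE/= in_itv/= andbT => t0.
  by rewrite powR_mulrn ?ltW// mulrC.
rewrite integral_itv_obnd_cbnd; last first.
  apply/measurable_EFinP; apply: measurable_funTS.
  exact: continuous_measurable_fun.
pose F (t : R) := - n`!%:R * reg_upper_gamma n.+1 t.
have dF (t : R) : is_derive t 1 F (f t).
  have -> : F = (- n`!%:R) *: reg_upper_gamma n.+1 by [].
  have := is_derive_reg_upper_gamma n t => dT.
  apply: is_derive_eq; rewrite /GRing.scale/= /f.
  have nf : n`!%:R != 0 :> R by rewrite pnatr_eq0 -lt0n fact_gt0.
  by field.
rewrite (@ge0_continuous_FTC2y _ f F 0 0).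
- by rewrite /F reg_upper_gamma0 mulr1 -EFinB sub0r opprK.
- by move=> t t0; rewrite mulr_ge0 ?expR_ge0 ?exprn_ge0.
- exact: continuous_subspaceT.
- rewrite -[0](mulr0 (- n`!%:R)).
  by apply: cvgM; [exact: cvg_cst|exact: cvg_reg_upper_gamma].
- by move=> t _; have [] := dF t.
- apply: cvg_at_right_filter.
  by have [/derivable1_diffP/differentiable_continuous] := dF 0.
- by move=> t _; rewrite derive1E; have [] := dF t.
Qed.

(** * One term of the geometric expansion *)

Lemma is_derive_ge0_le (R : realType) (f f' : R -> R) (a b : R) : a <= b ->
  (forall x, x \in `[a, b] -> is_derive x 1 f (f' x)) ->
  (forall x, x \in `[a, b] -> 0 <= f' x) -> f a <= f b.
Proof.
move=> ab df f'_ge0.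
have [c cab] := MVT_segment ab (fun x xab => df x (subset_itv_oo_cc xab))
  (is_derive_within_continuous df).
by rewrite -subr_ge0 => ->; rewrite mulr_ge0 ?f'_ge0// subr_ge0.
Qed.

(** With n = m.+3, the product of n! / k^n and 1 - Q(n, k) is the integral of
    e^(- k x^(1/n)) over [0, 1], in other words that of n t^(n-1) e^(- k t).
    Integrating by parts, it exceeds e^(-k) by the integral of k t^n e^(- k t)
    over [0, 1]; as (k t)^3 e^(- k t) <= 6, the latter integrand is at most
    6 t^(n-3) / k^2, whose integral is the right-hand side. *)
Lemma unit_interval_integral_bounds (R : realType) (m : nat) (k : R) : 0 < k ->
  0 <= m.+3`!%:R / k ^+ m.+3 * (1 - reg_upper_gamma m.+3 k) - expR (- k)
    <= 6 / (k ^+ 2 * m.+1%:R).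
Proof.
move=> k0; have k0' : k != 0 by rewrite gt_eqF.
pose c := m.+3`!%:R / k ^+ m.+3.
(* W is the primitive vanishing at 0 of the remainder k t^n e^(- k t). *)
pose W t := c * (1 - reg_upper_gamma m.+3 (k * t)) - t ^+ m.+3 * expR (- (k * t)).
pose W' t := k * t ^+ m.+3 * expR (- (k * t)).
have dT (t : R) : is_derive t 1 (fun t => reg_upper_gamma m.+3 (k * t))
    (- (expR (- (k * t)) * ((k * t) ^+ m.+2 / m.+2`!%:R)) * k).
  have dk : is_derive t 1 (fun t => k * t) k.
    have -> : (fun t : R => k * t) = k *: id by [].
    by apply: is_derive_eq; rewrite /GRing.scale/= mulr1.
  exact: (is_derive1_comp (is_derive_reg_upper_gamma m.+2 (k * t)) dk).
have dW (t : R) : is_derive t 1 W (W' t).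
  have := is_derive_expRNM k t => dE.
  have dcT := is_deriveZ c (is_deriveB (is_derive_cst (1 : R) t 1) (dT t)).
  have dtE := is_deriveM (is_deriveX m.+3 (is_derive_id t 1)) dE.
  have -> : W = (c \*: (cst 1 - (fun t => reg_upper_gamma m.+3 (k * t)))) -
      id ^+ m.+3 * (fun t => expR (- (k * t))).
    by apply/funext => x; rewrite !fctE.
  refine (is_derive_eq (is_deriveB dcT dtE) _).
  rewrite !fctE /= /GRing.scale /= /W' /c factS natrM exprMn.
  have nf : m.+2`!%:R != 0 :> R by rewrite pnatr_eq0 -lt0n fact_gt0.
  rewrite (exprS t m.+2) (exprS k m.+2).
  have kn : k ^+ m.+2 != 0 by rewrite expf_neq0.
  by field; rewrite k0' kn nf.
have W0 : W 0 = 0.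
  by rewrite /W mulr0 reg_upper_gamma0 subrr mulr0 expr0n/= mul0r subrr.
have W1 : W 1 = c * (1 - reg_upper_gamma m.+3 k) - expR (- k).
  by rewrite /W mulr1 expr1n mul1r.
rewrite -/c -W1; apply/andP; split.
  rewrite -W0; apply: (is_derive_ge0_le ler01 (fun x _ => dW x)) => x.
  rewrite in_itv/= => /andP[x0 _].
  exact: mulr_ge0 (mulr_ge0 (ltW k0) (exprn_ge0 _ x0)) (expR_ge0 _).
pose a : R := 6 / (k ^+ 2 * m.+1%:R).
(* a t^(m+1) is the primitive of the upper bound 6 t^m / k^2 for W'. *)
pose V t := a * t ^+ m.+1 - W t.
have dV (t : R) : is_derive t 1 V (6 / k ^+ 2 * t ^+ m - W' t).
  have dat := is_deriveZ a (is_deriveX m.+1 (is_derive_id t 1)).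
  have -> : V = (a \*: (id ^+ m.+1)) - W.
    by apply/funext => x; rewrite !fctE.
  refine (is_derive_eq (is_deriveB dat (dW t)) _).
  rewrite /GRing.scale /= /a.
  have m1 : m.+1%:R != 0 :> R by rewrite pnatr_eq0.
  by field; rewrite nat1r m1 k0'.
have V0 : V 0 = 0 by rewrite /V W0 expr0n/= mulr0 subrr.
have : V 0 <= V 1.
  apply: (is_derive_ge0_le ler01 (fun x _ => dV x)) => x.
  rewrite in_itv/= => /andP[x0 _].
  have := poisson_weight_le1 3 (mulr_ge0 (ltW k0) x0).
  rewrite subr_ge0 /W'.
  have -> : k * x ^+ m.+3 * expR (- (k * x)) =
    expR (- (k * x)) * ((k * x) ^+ 3 / 3`!%:R) * (6 / k ^+ 2 * x ^+ m).
    rewrite (_ : 3`! = 6)// -(addn3 m) exprD; field.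
    by rewrite k0'.
  move=> h; apply: ler_piMl => //; apply: mulr_ge0; last exact: exprn_ge0.
  by apply: divr_ge0 => //; exact: exprn_ge0 (ltW k0).
by rewrite V0 /V expr1n mulr1 subr_ge0.
Qed.

Lemma cvgn_powRyy (R : realType) (s : R) : 0 < s ->
  j.+1%:R `^ s @[j --> \oo] --> +oo.
Proof.
move=> s0; apply/cvgryPge => A; near=> j.
have A0 : 0 <= Num.max A 0 by rewrite le_max lexx orbT.
apply: (@le_trans _ _ (Num.max A 0)); first by rewrite le_max lexx.
have {1}-> : Num.max A 0 = ((Num.max A 0) `^ s^-1) `^ s.
  by rewrite -powRrM mulVf ?gt_eqF// powRr1.
apply: ge0_ler_powR; rewrite ?nnegrE ?powR_ge0 ?ltW//.
apply: (@lt_le_trans _ _ j%:R); last by rewrite ler_nat.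
by near: j; exact: nbhs_infty_gtr.
Unshelve. all: by end_near. Qed.

(** For n = m.+3 and g(x) = e^(- k x^(1/n)), the comparison on [1, +oo[ gives
    the sum as e^(-k) / 2 plus the integral of g over [1, +oo[, with an error
    of at most - g'(1) / 2 = k e^(-k) / (2 n) <= 3 / (n k^2).  The integral over
    [1, +oo[ is n! / k^n minus the integral over [0, 1], which is e^(-k) up to
    6 / ((n - 2) k^2).  The two errors have opposite signs, so the larger of
    the two bounds controls their total. *)
Lemma exp_root_series_asymptotics (R : realType) (m : nat) (k : R) : 0 < k ->
  exists2 S : R,
    (\sum_(0 <= j < N) expR (- (k * j.+1%:R `^ m.+3%:R^-1))) @[N --> \oo] --> S &
    `|S - (m.+3`!%:R / k ^+ m.+3 - expR (- k) / 2)| <= 6 / (k ^+ 2 * m.+1%:R).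
Proof.
move=> k0; have k_ge0 := ltW k0; have k_neq0 : k != 0 by rewrite gt_eqF.
pose s : R := m.+3%:R^-1.
have s_gt0 : 0 < s by rewrite invr_gt0.
have s_le1 : s <= 1 by rewrite invf_le1// ler1n.
pose c : R := m.+3`!%:R / k ^+ m.+3.
pose g x := expR (- (k * x `^ s)).
pose F x := - c * reg_upper_gamma m.+3 (k * x `^ s).
pose g' x := - (k * s) * (expR (- (k * x `^ s)) * x `^ (s - 1)).
have dpow (x : R) : 1 <= x -> is_derive x 1 (fun y => y `^ s) (s * x `^ (s - 1)).
  by move=> x1; apply: is_derive1_powR; exact: lt_le_trans x1.
have dg (x : R) : 1 <= x -> is_derive x 1 g (g' x).
  move=> /dpow dx.
  refine (is_derive_eq (is_derive1_comp (g := fun y => y `^ s)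
    (is_derive_expRNM k (x `^ s)) dx) _).
  by rewrite /g'; ring.
have dF (x : R) : 1 <= x -> is_derive x 1 F (g x).
  move=> x1; have x0 : 0 < x := lt_le_trans ltr01 x1.
  have dkx : is_derive x 1 (fun y => k * y `^ s) (k * (s * x `^ (s - 1))).
    have d := is_deriveZ k (dpow x x1); exact: d.
  have dT := is_derive1_comp (g := fun y => k * y `^ s)
    (is_derive_reg_upper_gamma m.+2 (k * x `^ s)) dkx.
  have dcT := is_deriveZ (- c) dT.
  refine (is_derive_eq dcT _).
  (* With s = 1/n, the chain rule produces x^(s-1) (x^s)^(n-1), which is 1. *)
  have xx : x `^ (s - 1) = ((x `^ s) ^+ m.+2)^-1.
    rewrite -powR_mulrn ?powR_ge0// -powRrM -powRN; congr (_ `^ _).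
    have m0 : m.+3%:R != 0 :> R by rewrite pnatr_eq0.
    have : s * m.+3%:R = 1 by rewrite mulVf.
    by rewrite -natr1 mulrDr mulr1; set z := s * _; lra.
  rewrite /GRing.scale/= xx /g /c /s exprMn factS natrM.
  have nf : m.+2`!%:R != 0 :> R by rewrite pnatr_eq0 -lt0n fact_gt0.
  have m0 : m.+3%:R != 0 :> R by rewrite pnatr_eq0.
  have kn : k ^+ m.+2 != 0 by rewrite expf_neq0.
  have xn : (x `^ m.+3%:R^-1) ^+ m.+2 != 0 by rewrite expf_neq0// gt_eqF// powR_gt0.
  rewrite [k ^+ m.+3]exprS.
  set a := _ ^+ m.+2 in xn *; set b := k ^+ m.+2 in kn *.
  by field; rewrite xn -natrD pnatr_eq0 nf kn k_neq0.
(* - g' is a product of two nonnegative nonincreasing functions. *)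
have g'_homo (x y : R) : 1 <= x -> x <= y -> g' x <= g' y.
  move=> x1 xy; have x0 := lt_le_trans ltr01 x1; have y0 := lt_le_trans x0 xy.
  rewrite /g' !mulNr lerN2; apply: ler_wpM2l; first by rewrite mulr_ge0// ltW.
  apply: ler_pM; rewrite ?expR_ge0 ?powR_ge0//.
    rewrite ler_expR lerN2; apply: ler_wpM2l => //.
    by apply: ge0_ler_powR; rewrite ?nnegrE ?(ltW x0) ?(ltW y0) ?(ltW s_gt0).
  rewrite -opprB !powRN lef_pV2 ?posrE ?powR_gt0//.
  by apply: ge0_ler_powR; rewrite ?nnegrE ?(ltW x0) ?(ltW y0)// subr_ge0.
have g'_le0 (x : R) : 1 <= x -> g' x <= 0.
  move=> _; rewrite /g' mulNr oppr_le0.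
  by rewrite !mulr_ge0 ?expR_ge0 ?powR_ge0// ltW.
have kj : (k * j.+1%:R `^ s) @[j --> \oo] --> +oo.
  apply/cvgryPge => A; near=> j.
  rewrite -ler_pdivrMl//.
  by near: j; have /cvgryPge := cvgn_powRyy s_gt0; exact.
have g0 : g j.+1%:R @[j --> \oo] --> 0.
  exact: (cvg_comp _ _ kj (@cvgr_expR R)).
have F0 : F j.+1%:R @[j --> \oo] --> 0.
  rewrite -[0](mulr0 (- c)); apply: cvgM; first exact: cvg_cst.
  exact: (cvg_comp _ _ kj (@cvg_reg_upper_gamma R m.+3)).
have [S cvgS] := sum_minus_integral_bounds dF dg g'_homo g'_le0 F0 g0.
rewrite /g /F /g' powR1 mulr1 mulr1 => /andP[lo hi].
exists S => //.
have /andP[lo1 hi1] := unit_interval_integral_bounds m k0.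
rewrite -/c in lo1 hi1 *.
have small : k * s * expR (- k) / 2 <= 6 / (k ^+ 2 * m.+1%:R).
  have p1 := poisson_weight_le1 3 k_ge0.
  have -> : k * s * expR (- k) / 2 =
      expR (- k) * (k ^+ 3 / 3`!%:R) * (3 / k ^+ 2 * s).
    by rewrite (_ : 3`! = 6)//; field.
  have k2 : 0 <= 3 / k ^+ 2 by rewrite divr_ge0// exprn_ge0.
  have sm : s <= m.+1%:R^-1 by rewrite lef_pV2 ?posrE// ler_nat leqW.
  apply: (@le_trans _ _ (3 / k ^+ 2 * s)).
    by apply: ler_piMl => //; rewrite mulr_ge0// ltW.
  rewrite (invfM (k ^+ 2)) mulrA; apply: (ler_pM k2 (ltW s_gt0) _ sm).
  by rewrite ler_wpM2r ?invr_ge0 ?exprn_ge0// ler_nat.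
move: lo hi lo1 hi1 small; rewrite !mulNr opprK !mulrBr mulr1.
(* The remaining inequalities are linear in these quantities. *)
move: (c) (c * _) (expR (- k)) (k * s * _) (6 / _) => c' cT e x B *.
by rewrite ler_norml; apply/andP; split; lra.
Unshelve. all: by end_near. Qed.

(** * Summation over the geometric expansion *)

Lemma eseries_EFin (R : realType) (u : R ^nat) (S : R) :
  series u @ \oo --> S -> (\sum_(j <oo) (u j)%:E)%E = S%:E.
Proof.
move=> uS; apply/cvg_lim => //.
under eq_cvg do rewrite sumEFin.
by apply: cvg_EFin; [exact: nearW|exact: uS].
Qed.

Lemma eseries1 (R : realType) (f : nat -> \bar R) : (forall j, 0 <= f j)%E ->
  (\sum_(1 <= j <oo) f j = \sum_(j <oo) f j.+1)%E.
Proof.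
move=> f0; rewrite -(nneseries_addn 1 f0).
by apply: eq_eseriesr => j _; rewrite addn1.
Qed.

Lemma cvg_series_expRN (R : realType) (t : R) : 0 < t ->
  series (fun k => expR (- (k.+1%:R * t))) @ \oo --> (expR t - 1)^-1.
Proof.
move=> t0.
have q1 : `|expR (- t)| < 1.
  by rewrite ger0_norm ?expR_ge0// -expR0 ltr_expR oppr_lt0.
have := @cvg_geometric_series R (expR (- t)) _ q1.
have -> : geometric (expR (- t)) (expR (- t)) =
    (fun k => expR (- (k.+1%:R * t))).
  by apply/funext => k /=; rewrite -exprS -mulrN expRM_natl.
have -> // : expR (- t) * (1 - expR (- t))^-1 = (expR t - 1)^-1.
have e0 : expR t != 0 by rewrite gt_eqF ?expR_gt0.
have e1 : expR t - 1 != 0 by rewrite subr_eq0 gt_eqF// expR_gt1.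
by rewrite expRN; field; rewrite e0 e1.
Qed.

(** The sum is 1 by telescoping; it serves as an explicit majorant for the
    series of 1 / k^2. *)
Lemma cvg_series_telescope (R : realType) :
  series (fun k => (k.+1%:R * k.+2%:R)^-1 : R) @ \oo --> (1 : R).
Proof.
have -> : series (fun k => (k.+1%:R * k.+2%:R)^-1 : R) =
    (fun n => 1 - harmonic n).
  apply/funext; elim => [|n IH]; first by rewrite /series/= big_geq// invr1 subrr.
  rewrite seriesSr IH /=.
  have n1 : n.+1%:R != 0 :> R by rewrite pnatr_eq0.
  have n2 : n.+2%:R != 0 :> R by rewrite pnatr_eq0.
  have e : n.+2%:R = n.+1%:R + 1 :> R by rewrite natr1.
  move: n1 n2; rewrite e; move: (n.+1%:R) => a a0 a1.
  by field; rewrite a0 a1.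
rewrite -[X in _ --> X]subr0; apply: cvgB; [exact: cvg_cst|exact: cvg_harmonic].
Qed.

Lemma invr_sqr_le_telescope (R : realType) (k : nat) :
  (k.+1%:R ^+ 2)^-1 <= 2 * (k.+1%:R * k.+2%:R)^-1 :> R.
Proof.
have k1 : 0 < k.+1%:R :> R by [].
have k2 : 0 < k.+2%:R :> R by [].
rewrite expr2 !invfM mulrCA ler_pM2l ?invr_gt0// ler_pdivlMr//.
rewrite mulrC ler_pdivrMr// -natrM ler_nat.
by rewrite mul2n -addnn addSnnS -[k.+2]add0n leq_add2r.
Qed.

(** Exchanging the summations turns the left-hand series into the sum over k of
    the sums S k of the k-th exponentials, and zeta(n) Gamma(n+1) is the sum of
    n! / k^n.  The differences d k between S k and n! / k^n - e^(-k) / 2 are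
    dominated by 12 / (m + 1) times a telescoping series of sum 1, and the
    series of e^(-k) / 2 gives - 1 / (2 (e - 1)) = 1 / (2 - 2 e).  The index k
    runs from 0 here, so that k.+1 is the summation variable above. *)
Lemma double_series_asymptotics (R : realType) (m : nat) :
  exists2 r : R, `|r| <= 12 / m.+1%:R &
  (\sum_(1 <= j <oo) ((expR (j%:R `^ m.+3%:R^-1) - 1)^-1)%:E
    - zeta (m.+3%:R : R) * Gamma (m.+3%:R + 1 : R) =
   (1 / (2 - 2 * expR 1) + r)%:E)%E.
Proof.
pose s : R := m.+3%:R^-1.
pose w k : R := (k.+1%:R * k.+2%:R)^-1.
have w_ge0 k : 0 <= w k by rewrite invr_ge0.
have w_cvg : series w @ \oo --> (1 : R) := @cvg_series_telescope R.
pose z k : R := (k.+1%:R ^+ m.+3)^-1.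
have z_ge0 k : 0 <= z k by rewrite invr_ge0 exprn_ge0.
have z_cvg : cvgn (series z).
  apply: (@series_le_cvg _ _ (2 *: w)) => // [k|k|].
  - by rewrite /GRing.scale/= mulr_ge0.
  - apply: le_trans (invr_sqr_le_telescope R k).
    rewrite lef_pV2 ?posrE ?exprn_gt0//.
    by rewrite ler_weXn2l// ler1n.
  - by apply: is_cvg_seriesZ; apply/cvg_ex; exists (1 : R).
pose e (k : nat) : R := expR (- (k.+1%:R * 1)).
have e_cvg : series e @ \oo --> (expR 1 - 1)^-1 := cvg_series_expRN ltr01.
pose S k := limn (series (fun j => expR (- (k.+1%:R * j.+1%:R `^ s)))).
pose d k := S k - (m.+3`!%:R * z k - e k / 2).
have dS k : series (fun j => expR (- (k.+1%:R * j.+1%:R `^ s))) @ \oo --> S k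
    /\ `|d k| <= 12 / m.+1%:R * w k.
  have [Sk cvgS leS] := exp_root_series_asymptotics m (ltr0Sn R k).
  have ES : S k = Sk by apply/cvg_lim.
  split; first by rewrite ES.
  rewrite /d ES /z /e mulr1; apply: le_trans leS _.
  have -> : 6 / (k.+1%:R ^+ 2 * m.+1%:R) = (k.+1%:R ^+ 2)^-1 * (6 / m.+1%:R) :> R.
    by rewrite [in LHS]invfM mulrCA.
  have -> : 12 / m.+1%:R * w k = (2 * w k) * (6 / m.+1%:R) by ring.
  by apply: ler_wpM2r; [rewrite divr_ge0|exact: invr_sqr_le_telescope].
have bw_cvg : series ((12 / m.+1%:R) *: w) @ \oo --> (12 / m.+1%:R : R).
  rewrite (_ : series _ = (12 / m.+1%:R) *: series w).
    by rewrite -[X in _ --> X]mulr1; apply: cvgZr; exact: w_cvg.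
  by apply/funext => N; rewrite !fctE /series/= /GRing.scale/= mulr_sumr.
have nd_cvg : cvgn [normed series d].
  apply: (@series_le_cvg _ _ ((12 / m.+1%:R) *: w)) => [k|k|k|].
  - exact: normr_ge0.
  - by rewrite mulr_ge0// divr_ge0.
  - by have [] := dS k.
  - by apply/cvg_ex; exists (12 / m.+1%:R : R).
exists (limn (series d)).
  apply: le_trans (lim_series_norm nd_cvg) _.
  rewrite -(cvg_lim _ bw_cvg)//; apply: lim_series_le => // [|k].
    by apply/cvg_ex; exists (12 / m.+1%:R : R).
  by have [] := dS k.
have S_cvg : series S @ \oo -->
    m.+3`!%:R * limn (series z) - (expR 1 - 1)^-1 / 2 + limn (series d).
  rewrite (_ : series S =
      (m.+3`!%:R *: series z - series e * cst 2^-1) + series d); last first.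
    apply/funext => N; rewrite !fctE /series/= /GRing.scale/=.
    rewrite mulr_sumr mulr_suml -sumrB -big_split/=.
    by apply: eq_bigr => k _; rewrite /d addrC subrK.
  apply: cvgD; last exact: normed_cvg.
  apply: cvgB; first exact: cvgZr.
  by apply: cvgM => //; exact: cvg_cst.
have -> : (\sum_(1 <= j <oo) ((expR (j%:R `^ s) - 1)^-1)%:E)%E =
    (m.+3`!%:R * limn (series z) - (expR 1 - 1)^-1 / 2 + limn (series d))%:E.
  rewrite eseries1; last first.
    by move=> j; rewrite lee_fin invr_ge0 subr_ge0 -expR0 ler_expR powR_ge0.
  rewrite -(eseries_EFin S_cvg).
  transitivity (\sum_(j <oo) \sum_(k <oo)
      (expR (- (k.+1%:R * j.+1%:R `^ s)))%:E)%E.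
    apply: eq_eseriesr => j _; apply/esym/eseries_EFin.
    by apply: cvg_series_expRN; exact: powR_gt0.
  rewrite nneseries_interchange; last by move=> i j; rewrite lee_fin expR_ge0.
  by apply: eq_eseriesr => k _; apply: eseries_EFin; have [] := dS k.
have -> : zeta (m.+3%:R : R) = (limn (series z))%:E.
  rewrite /zeta eseries1; last by move=> j; rewrite lee_fin invr_ge0 powR_ge0.
  rewrite -(eseries_EFin z_cvg); apply: eq_eseriesr => k _.
  by rewrite powR_mulrn.
rewrite Gamma_natS -EFinM -EFinB; congr EFin.
have e1 : expR 1 - 1 != 0 :> R by rewrite subr_eq0 gt_eqF// expR_gt1.
have -> : 2 - 2 * expR 1 = - (2 * (expR 1 - 1)) :> R by ring.
by field; rewrite e1.
Qed.

Lemma cvg_of_harmonic_bound (R : realType) (u : R ^nat) (l C : R) :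
  (forall m, `|u m - l| <= C / m.+1%:R) -> u @ \oo --> l.
Proof.
move=> ul.
have C0 : (C * harmonic m) @[m --> \oo] --> (0 : R).
  rewrite -[X in _ --> X](mulr0 C); apply: cvgM; first exact: cvg_cst.
  exact: cvg_harmonic.
apply: (squeeze_cvgr (f := fun m => l - C * harmonic m)
  (h := fun m => l + C * harmonic m)).
- by apply: nearW => m; rewrite -ler_distl; exact: ul.
- by rewrite -[X in _ --> X]subr0; apply: cvgB => //; exact: cvg_cst.
- by rewrite -[X in _ --> X]addr0; apply: cvgD => //; exact: cvg_cst.
Qed.

Local Open Scope ereal_scope.

Theorem mainTheorem8 (R : realType) :
  (\sum_(1 <= j <oo) ((expR (j%:R `^ n%:R^-1) - 1)^-1)%:E
     - zeta (n%:R : R) * Gamma (n%:R + 1 : R)) @[n --> \oo]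
  --> ((1 / (2 - 2 * expR 1))%:E : \bar R).
Proof.
rewrite -(cvg_shiftn 3); apply/fine_cvgP; split.
  apply: nearW => m /=; rewrite addn3.
  by have [r _ ->] := double_series_asymptotics R m.
apply: (@cvg_of_harmonic_bound _ _ _ 12) => m /=; rewrite addn3.
have [r r_le ->] := double_series_asymptotics R m.
by rewrite /= addrAC subrr add0r.
Qed.
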